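(* A class of graphs $\mathcal{X}$ is a function of $\mathcal{L}$ if and only if there exists an integer $k\ge 0$ such that every graph in $\mathcal{X}$ has a twin class that contains all but at most $k$ vertices.
   Context: All graphs are finite and simple; a class of graphs is a set of graphs closed under isomorphism. $\mathcal{L}$ is the class consisting of all complete graphs and all graphs with exactly two connected components, one of which is a single isolated vertex and the other a complete graph. Two vertices $a,b$ of a graph are twins if $N(a)\setminus\{b\}=N(b)\setminus\{a\}$; this is an equivalence relation whose classes are called twin classes. For a graph $G$ and distinct vertices $u,w$, $G(u,w)=1$ if they are adjacent and $0$ otherwise. If $G,H_1,\dots,H_k$ are graphs on the same vertex set $V$, $G$ is a (boolean) function of $H_1,\dots,H_k$ if there is a boolean function $f:\{0,1\}^k\to\{0,1\}$ with $G(a,b)=f(H_1(a,b),\dots,H_k(a,b))$ for all distinct $a,b\in V$. A class $\mathcal{Y}$ is a $k$-function of $\mathcal{X}$ if every $G\in\mathcal{Y}$ is a function of at most $k$ graphs from $\mathcal{X}$ (on the vertex set of $G$); $\mathcal{Y}$ is a function of $\mathcal{X}$ if it is a $k$-function for some $k\in\mathbb{N}$. *)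

(* Defs.v *)
From mathcomp Require Import all_boot.

Set Implicit Arguments.
Unset Strict Implicit.
Unset Printing Implicit Defensive.

(* Graphs have at least one vertex: the graph without vertices has no twin
   class at all, although it is vacuously a function of any graphs. *)
Record sgraph (V : finType) := SGraph {
  adj :> rel V;
  adj_sym : symmetric adj;
  adj_irrefl : irreflexive adj;
  sgraph_nonempty : 0 < #|V|
}.

Definition isomorphic (V W : finType) (G : sgraph V) (H : sgraph W) : Prop :=
  exists2 f : V -> W, bijective f & forall x y, adj H (f x) (f y) = adj G x y.

Definition graph_family := forall V : finType, sgraph V -> Prop.

Definition is_graph_class (X : graph_family) : Prop :=
  forall (V W : finType) (G : sgraph V) (H : sgraph W),
    isomorphic G H -> X V G -> X W H.

Section OneGraph.

Variables (V : finType) (G : sgraph V).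

Definition nbhd (a : V) : {set V} := [set b | adj G a b].

Definition twins : rel V := fun a b => nbhd a :\ b == nbhd b :\ a.

Definition twin_classes : {set {set V}} := equivalence_partition twins [set: V].

Definition components : {set {set V}} :=
  equivalence_partition (connect (adj G)) [set: V].

Definition induces_complete (D : {set V}) : Prop :=
  forall x y, x \in D -> y \in D -> x != y -> adj G x y.

Definition is_complete : Prop := induces_complete [set: V].

Definition is_point_plus_complete : Prop :=
  exists (v : V) (D : {set V}),
    [/\ [set v] != D, components = [set [set v]; D] & induces_complete D].

End OneGraph.

Definition class_L : graph_family :=
  fun V G => is_complete G \/ is_point_plus_complete G.

Definition is_function_of_graphs (V : finType) (G : sgraph V)
    (m : nat) (H : 'I_m -> sgraph V) : Prop :=
  exists f : {ffun 'I_m -> bool} -> bool,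
    forall a b : V, a != b -> adj G a b = f [ffun i => adj (H i) a b].

Definition is_k_function_of (k : nat) (Y X : graph_family) : Prop :=
  forall (V : finType) (G : sgraph V), Y V G ->
    exists m : nat, m <= k /\
      exists H : 'I_m -> sgraph V,
        (forall i, X V (H i)) /\ is_function_of_graphs G H.

Definition is_function_of (Y X : graph_family) : Prop :=
  exists k : nat, is_k_function_of k Y X.

(* Main.v *)
Require Import Defs.
From mathcomp Require Import all_boot.

(** Up to its isolated vertex, a graph of L carries no information: for distinct
    [a], [b] it only says whether [a] or [b] is that vertex. Hence, if G is a
    function of k graphs of L, the vertices other than the at most k isolated
    ones are pairwise twins. Conversely, let C be a twin class of G. For each
    vertex [v] outside C take the graph of L whose isolated vertex is [v];
    together these graphs determine the trace of [{a, b}] on the complement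
    of C, and this trace determines the adjacency of [a] and [b] in G. *)

Set Implicit Arguments.
Unset Strict Implicit.
Unset Printing Implicit Defensive.

(** * Twins, and pairs with the same trace outside a twin class *)

Section Twins.

Variables (V : finType) (G : sgraph V).

Lemma twinsP (x y : V) :
  reflect (forall z, z != x -> z != y -> adj G x z = adj G y z) (twins G x y).
Proof.
apply: (iffP eqP) => [e z zx zy|e].
  by move/setP/(_ z): e; rewrite !inE zx zy.
apply/setP=> z; rewrite !inE.
have [->|zx] := eqVneq z x; first by rewrite adj_irrefl andbF.
have [->|zy] := eqVneq z y; first by rewrite adj_irrefl.
exact: e.
Qed.

Lemma twins_refl : reflexive (twins G).
Proof. by move=> x; apply/twinsP. Qed.

Lemma twins_sym : symmetric (twins G).
Proof. by move=> x y; rewrite /twins eq_sym. Qed.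

Lemma twins_trans : transitive (twins G).
Proof.
move=> y x w /twinsP xy /twinsP yw; apply/twinsP=> z zx zw.
(* Only [z = y] escapes the two hypotheses; there, the pairs [xy], [xw] and [yw] all have the same
   adjacency. *)
have [zy|zy] := eqVneq z y; last by rewrite xy // yw.
rewrite {}zy {z} in zx zw *.
have [->//|wx] := eqVneq w x.
rewrite (adj_sym G x) yw ?[x == _]eq_sym //.
by rewrite (adj_sym G w x) xy ?[w == y]eq_sym // (adj_sym G w).
Qed.

Lemma mem_twin_classP (C : {set V}) :
  reflect (exists x, C = [set y | twins G x y]) (C \in twin_classes G).
Proof.
apply: (iffP imsetP) => [[x _ ->]|[x ->]]; exists x => //;
  by apply/setP=> y; rewrite !inE.
Qed.

Lemma twin_class_twins (C : {set V}) (x y : V) :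
  C \in twin_classes G -> x \in C -> y \in C -> twins G x y.
Proof.
case/mem_twin_classP=> c ->; rewrite !inE twins_sym => xc cy.
exact: twins_trans xc cy.
Qed.

(** Equal traces mean that the two pairs differ only in their endpoints inside [C]. Exchanging such
    an endpoint for a twin preserves adjacency, so one pair is turned into the other one endpoint at
    a time. *)
Lemma adj_eq_of_same_trace (C : {set V}) (a b c d : V) :
  C \in twin_classes G -> a != b -> c != d ->
  (forall v, v \notin C -> ((v == a) || (v == b)) = ((v == c) || (v == d))) ->
  adj G a b = adj G c d.
Proof.
move=> CG.
have tw x y z : x \in C -> y \in C -> z != x -> z != y -> adj G x z = adj G y z.
  by move=> xC yC; apply/twinsP/(twin_class_twins CG).
have mixed x y z w : x \notin C -> y \in C -> x != y -> z != w -> x == z ->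
    (forall v, v \notin C -> ((v == x) || (v == y)) = ((v == z) || (v == w))) ->
    adj G x y = adj G z w.
  move=> xC yC xy zw /eqP xz; rewrite -{}xz {z} in zw * => tr.
  have wC : w \in C.
    apply: contraT => wC; move: (tr w wC).
    rewrite eqxx orbT eq_sym (negPf zw) => /eqP wy.
    by rewrite wy yC in wC.
  by rewrite !(adj_sym G x); apply: tw.
(* The outer vertex [x] may also be listed second in the other pair. *)
have mixedU x y z w : x \notin C -> y \in C -> x != y -> z != w ->
    (forall v, v \notin C -> ((v == x) || (v == y)) = ((v == z) || (v == w))) ->
    adj G x y = adj G z w.
  move=> xC yC xy zw tr.
  have := tr x xC; rewrite eqxx /= => /esym/orP[xz|xw]; first exact: mixed.
  rewrite (adj_sym G z); apply: mixed => //; first by rewrite eq_sym.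
  by move=> v vC; rewrite orbC [RHS]orbC -tr // orbC.
move=> ab cd tr.
have [aC|aC] := boolP (a \in C); have [bC|bC] := boolP (b \in C).
- have cC : c \in C.
    apply: contraT => cC; have := tr c cC; rewrite eqxx /=.
    by case/orP=> /eqP ce; rewrite ce ?aC ?bC in cC.
  have dC : d \in C.
    apply: contraT => dC; have := tr d dC; rewrite eqxx orbT.
    by case/orP=> /eqP de; rewrite de ?aC ?bC in dC.
  (* The route is [ab], [ad], [cd]. The middle pair degenerates if [a = d], and then [b] is
     exchanged for [c] directly. *)
  have [ad|ad] := eqVneq a d.
    by rewrite (adj_sym G a) -ad; apply: tw => //; rewrite ad eq_sym.
  rewrite (adj_sym G a) (tw b d a) // (adj_sym G d).
  by apply: tw; rewrite // eq_sym.
- rewrite adj_sym; apply: mixedU => //; first by rewrite eq_sym.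
  by move=> v vC; rewrite orbC tr.
- exact: mixedU.
- have := tr a aC; have := tr b bC; rewrite !eqxx orbT /=.
  case/esym/orP=> /eqP be /esym/orP[] /eqP ae; rewrite be ae ?eqxx // in ab *.
  exact: adj_sym.
Qed.

End Twins.

(** * Adjacency in the graphs of L *)

Lemma components_point_plus_complete (V : finType) (G : sgraph V) (v : V)
    (D : {set V}) (a b : V) :
  components G = [set [set v]; D] -> induces_complete G D -> a != b ->
  adj G a b = (a != v) && (b != v).
Proof.
move=> cG cD ab.
have comp x : [set y | connect (adj G) x y] \in [set [set v]; D].
  rewrite -cG; apply/imsetP; exists x => //.
  by apply/setP=> y; rewrite !inE.
have inD x : x != v -> x \in D.
  move=> xv; have := comp x; rewrite !inE.
  case/orP=> /eqP/setP/(_ x); rewrite !inE connect0 => /esym //.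
  by rewrite (negPf xv).
(* If [v] were in [D], both sets would be the component of [v], so [D = [set v]]; by [inD] no vertex
   would differ from [v], against [a != b]. *)
have vD : v \notin D.
  have : [set v] \in components G by rewrite cG !inE eqxx.
  have : D \in components G by rewrite cG !inE eqxx orbT.
  case/imsetP=> y _ De /imsetP[x _ ve].
  apply/negP => vD; move: (vD); rewrite De !inE /= => yv.
  have xv : connect (adj G) x v.
    by have := set11 v; rewrite ve !inE.
  have csym : connect_sym (adj G) by apply/sym_connect_sym/adj_sym.
  have De' : D = [set v].
    rewrite De ve; apply/setP=> z; rewrite !inE /=.
    by rewrite (same_connect csym yv) (same_connect csym xv).
  have [av|av] := eqVneq a v.
    have := inD b; rewrite De' inE -av eq_sym => /(_ ab).
    by rewrite (negPf ab).
  by have := inD a av; rewrite De' inE (negPf av).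
have nadj y : y != v -> adj G v y = false.
  move=> yv; apply/negP=> /connect1 vy; have := comp v; rewrite !inE.
  case/orP=> /eqP/setP e; first by have := e y; rewrite !inE vy (negPf yv).
  by have := e v; rewrite inE connect0 (negPf vD).
have [->|av] /= := eqVneq a v.
  have [bv|bv] := eqVneq b v; first by rewrite bv adj_irrefl.
  exact: nadj.
have [->|bv] /= := eqVneq b v; first by rewrite adj_sym nadj.
by apply: cD => //; apply: inD.
Qed.

(** [None] stands for a complete graph, so that one formula covers both kinds of graphs in L. *)
Lemma class_L_adj (V : finType) (G : sgraph V) :
  class_L G ->
  exists o : option V, forall a b, a != b ->
    adj G a b = (Some a != o) && (Some b != o).
Proof.
case=> [cG|[v [D [_ cG cD]]]]; first by exists None => a b ab; rewrite cG.
exists (Some v) => a b ab.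
by rewrite (components_point_plus_complete cG cD ab).
Qed.

Section PointPlusComplete.

Variables (V : finType) (v : V).

Definition point_plus_complete_rel : rel V :=
  fun a b => [&& a != b, a != v & b != v].

Lemma point_plus_complete_sym : symmetric point_plus_complete_rel.
Proof.
by move=> a b; rewrite /point_plus_complete_rel eq_sym [(a != v) && _]andbC.
Qed.

Lemma point_plus_complete_irrefl : irreflexive point_plus_complete_rel.
Proof. by move=> a; rewrite /point_plus_complete_rel eqxx. Qed.

Definition point_plus_complete : sgraph V :=
  SGraph point_plus_complete_sym point_plus_complete_irrefl
    (introT card_gt0P (ex_intro _ v isT)).

(** Every edge avoids [v] at both ends, hence so does every nonempty path. *)
Lemma connect_point_plus_complete (a b : V) :
  connect point_plus_complete_rel a b = (a == b) || (a != v) && (b != v).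
Proof.
apply/idP/idP; last first.
  have [->|ab] /= := eqVneq a b; first by rewrite connect0.
  by move=> abv; apply: connect1; apply/andP.
case/connectP=> [[|c p] /= cp ->]; first by rewrite eqxx.
case/andP: cp => /and3P[_ -> cv] cp /=; apply/orP; right.
elim: p c cv cp => //= d p IH c _ /andP[/and3P[_ _ dv]]; exact: IH.
Qed.

(** The vertex [w] makes the complement of [v] nonempty and represents it as a component. *)
Lemma point_plus_complete_class_L (w : V) :
  w != v -> class_L point_plus_complete.
Proof.
move=> wv; right; exists v, (~: [set v]); split.
- by apply/eqP=> /setP/(_ v); rewrite !inE eqxx.
- apply/setP=> A; rewrite !inE; apply/imsetP/orP.
    case=> x _ ->; have [->|xv] := eqVneq x v; [left|right];
      apply/eqP/setP=> y; rewrite !inE connect_point_plus_complete.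
      by rewrite eqxx orbF eq_sym.
    by rewrite xv /=; have [<-|] := eqVneq x y.
  case=> /eqP ->; [exists v|exists w] => //;
    apply/setP=> y; rewrite !inE connect_point_plus_complete.
    by rewrite eqxx orbF eq_sym.
  by rewrite wv /=; have [<-|] := eqVneq w y.
- by move=> x y; rewrite !inE /= => xv yv xy; apply/and3P.
Qed.

End PointPlusComplete.

(** * The two directions of the equivalence *)

Lemma twin_class_of_function_of_L (V : finType) (G : sgraph V) (m : nat)
    (H : 'I_m -> sgraph V) :
  (forall i, class_L (H i)) -> is_function_of_graphs G H ->
  exists2 C : {set V}, C \in twin_classes G & #|~: C| <= m.
Proof.
move=> HL [f Gf].
have [o Ho] : exists o : 'I_m -> option V, forall i a b, a != b ->
    adj (H i) a b = (Some a != o i) && (Some b != o i).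
  (* The property is put in boolean form so that [xchoose] can select one [o] for each [i]. *)
  have ex i : exists o : option V, [forall a, forall b, (a != b) ==>
      (adj (H i) a b == (Some a != o) && (Some b != o))].
    have [o Ho] := class_L_adj (HL i); exists o.
    apply/forallP=> a; apply/forallP=> b; apply/implyP=> ab.
    by apply/eqP; exact: Ho.
  exists (fun i => xchoose (ex i)) => i a b ab; apply/eqP.
  by move: (xchooseP (ex i)) => /forallP/(_ a)/forallP/(_ b)/implyP/(_ ab).
pose S := [set x | Some x \in codom o].
have cS : #|S| <= m.
  rewrite -(card_imset _ Some_inj) -[m in _ <= m]card_ord.
  rewrite -[#|'I_m|](size_codom o).
  apply: leq_trans (card_size _); apply: subset_leq_card.
  by apply/subsetP=> _ /imsetP[x xS ->]; rewrite inE in xS.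
have notS x i : x \notin S -> Some x != o i.
  by rewrite inE; apply: contraNneq => ->; apply: codom_f.
have twS x y : x \notin S -> y \notin S -> twins G x y.
  move=> xS yS; apply/twinsP=> z; rewrite !(eq_sym z) => xz yz.
  rewrite !Gf //; congr f; apply/ffunP=> i.
  by rewrite !ffunE !Ho // (notS x) // (notS y).
(* If the isolated vertices exhaust [V], then [V] has at most [m] vertices and the class of any
   vertex will do. *)
have [x xS] : exists x, (x \notin S) || (S == setT).
  have [->|] := eqVneq S setT.
    by case/card_gt0P: (sgraph_nonempty G) => x _; exists x; rewrite orbT.
  rewrite -subTset => /subsetPn[x _ xS]; by exists x; rewrite xS.
exists [set y | twins G x y]; first by apply/mem_twin_classP; exists x.
apply: leq_trans cS; apply: subset_leq_card; apply/subsetP=> y.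
rewrite in_setC in_set => xy; case/orP: xS => [xS|/eqP->]; last by [].
by apply: contraR xy => yS; apply: twS.
Qed.

Lemma function_of_L_of_twin_class (V : finType) (G : sgraph V) (C : {set V}) :
  C \in twin_classes G ->
  exists H : 'I_#|~: C| -> sgraph V,
    (forall i, class_L (H i)) /\ is_function_of_graphs G H.
Proof.
move=> CG.
have [c cC] : exists c, c \in C.
  by case/mem_twin_classP: CG => c ->; exists c; rewrite inE twins_refl.
pose H (i : 'I_#|~: C|) := point_plus_complete (enum_val i).
exists H; split=> [i|].
  apply: (@point_plus_complete_class_L _ _ c).
  by apply: contraTneq cC => ->; have := enum_valP i; rewrite inE.
pose vec a b := [ffun i => adj (H i) a b].
(* The function accepts exactly the vectors realised by an edge of [G]. It rejects non-edges because
   pairs with equal vectors have equal traces outside [C]. *)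
exists (fun x => [exists a, exists b, [&& a != b, adj G a b & x == vec a b]]).
move=> a b ab; apply/idP/existsP => [Gab|[c' /existsP[d /and3P[cd Gcd /eqP e]]]].
  by exists a; apply/existsP; exists b; rewrite ab Gab eqxx.
rewrite (adj_eq_of_same_trace CG ab cd) // => v vC.
have vC' : v \in ~: C by rewrite inE.
(* For distinct endpoints, the coordinate of [v] is the negation of [v] being one of them. *)
move/ffunP/(_ (enum_rank_in vC' v)): e; rewrite !ffunE /= /point_plus_complete_rel.
rewrite (enum_rankK_in vC' vC') ab cd /= -!negb_or => /negb_inj.
by rewrite !(eq_sym _ v).
Qed.

Theorem theorem4p10 (X : graph_family) (hX : is_graph_class X) :
  is_function_of X class_L <->
  exists k : nat, forall (V : finType) (G : sgraph V), X V G ->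
    exists2 C : {set V}, C \in twin_classes G & #|~: C| <= k.
Proof.
split=> [] [k Xk]; exists k => V G /Xk.
  case=> m [mk [H [HL GH]]].
  have [C CG Cm] := twin_class_of_function_of_L HL GH.
  by exists C => //; apply: leq_trans mk.
case=> C CG Ck; exists #|~: C|; split=> //.
exact: function_of_L_of_twin_class.
Qed.
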